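(* The following statements are true: (1) For every infinite cardinal $\kappa$, the spaces $(\mathrm{Met}(\ell^2(\kappa)),\mathcal{D}_{\ell^2(\kappa)})$ and $(\mathrm{Met}(B(\kappa)),\mathcal{D}_{B(\kappa)})$ are universal for $\mathscr{S}_\kappa$. Moreover, the spaces $(\mathrm{BMet}(\ell^2(\kappa)),\mathcal{D}_{\ell^2(\kappa)})$ and $(\mathrm{BMet}(B(\kappa)),\mathcal{D}_{B(\kappa)})$ are universal for $\mathrm{B}(\mathscr{S}_\kappa)$. (2) The space $(\mathrm{BMet}(\mathbf{Q}),\mathcal{D}_{\mathbf{Q}})$ is universal for $\mathscr{T}$. (3) For any metrizable space $Z$ such that there exists a continuous surjection from $Z$ to $\mathbf{Q}$, the space $(\mathrm{BMet}(Z),\mathcal{D}_Z)$ is universal for $\mathscr{T}$. In particular, $(\mathrm{BMet}(\Gamma),\mathcal{D}_\Gamma)$ is universal for $\mathscr{T}$. (4) For every uncountable Polish space $X$, the space $(\mathrm{BMet}(X),\mathcal{D}_X)$ is universal for $\mathscr{T}$.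
   Context: For a metrizable space $Z$, $\mathrm{Met}(Z)$ is the set of all metrics on $Z$ that generate the given topology of $Z$, and $\mathrm{BMet}(Z)$ is the set of all bounded metrics in $\mathrm{Met}(Z)$. The sup-metric is $\mathcal{D}_Z(d,e)=\sup_{x,y\in Z}|d(x,y)-e(x,y)|$ (a priori possibly taking the value $\infty$); subsets carry its restriction. A space $(M,\rho)$ is universal for a class of metric spaces if every member of the class admits an isometric (distance-preserving) embedding into $(M,\rho)$. $\mathscr{S}_\kappa$ is the class of all metric spaces of weight $\kappa$ (with the convention that $\mathscr{S}_{\aleph_0}$ is the class of all separable metric spaces); for a class $\mathscr{C}$ of metric spaces, $\mathrm{B}(\mathscr{C})$ is the class of all bounded members of $\mathscr{C}$; $\mathscr{T}$ is the class of all totally bounded metric spaces. $\ell^2(\kappa)$ is the Hilbert space of weight $\kappa$; $B(\kappa)=\kappa^{\aleph_0}$ is the countable power of the discrete space of cardinality $\kappa$ (product topology); $\mathbf{Q}=[0,1]^{\aleph_0}$ is the Hilbert cube; $\Gamma=\{0,1\}^{\aleph_0}$ is the Cantor set. *)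

(* Defs.v *)
From HB Require Import structures.
From mathcomp Require Import all_boot all_order all_algebra.
From mathcomp Require Import all_classical all_reals all_analysis.
From mathcomp Require Import ring lra.
Set Implicit Arguments.
Unset Strict Implicit.
Unset Printing Implicit Defensive.
Import Order.TTheory GRing.Theory Num.Theory.
Import numFieldNormedType.Exports.
Local Open Scope classical_set_scope.
Local Open Scope ring_scope.

Section spaces_of_metrics.
Context {R : realType}.

Definition is_metric (T : Type) (d : T -> T -> R) : Prop :=
  [/\ forall x, d x x = 0,
      forall x y, d x y = 0 -> x = y,
      forall x y, d x y = d y x
    & forall x y z, d x z <= d x y + d y z].

Definition Met (Z : topologicalType) : set (Z -> Z -> R) :=
  [set d | is_metric d /\
    forall x : Z, nbhs x = nbhs_ball_ (fun x r => [set y | d x y < r]) x].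
Arguments Met Z : clear implicits.

Definition BMet (Z : topologicalType) : set (Z -> Z -> R) :=
  [set d | Met Z d /\ exists M : R, forall x y, d x y <= M].

(* The supremum is taken in [0, +oo], hence the [maxe 0]: [ereal_sup] of the
   empty set is -oo. *)
Definition supdist (Z : Type) (d e : Z -> Z -> R) : \bar R :=
  maxe 0%E (ereal_sup [set `|d p.1 p.2 - e p.1 p.2|%:E | p in [set: Z * Z]]).

Definition universal (M : Type) (A : set M) (rho : M -> M -> \bar R)
    (C : metricType R -> Prop) : Prop :=
  forall X : metricType R, C X -> exists f : X -> M,
    (forall x, A (f x)) /\
    (forall x y, rho (f x) (f y) = (mdist x y)%:E).

Definition bounded_space (X : metricType R) : Prop :=
  exists M : R, forall x y : X, mdist x y <= M.

Definition bounded_class (C : metricType R -> Prop) (X : metricType R) : Prop :=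
  C X /\ bounded_space X.

Definition totally_bounded (X : metricType R) : Prop :=
  forall e : R, 0 < e ->
    exists2 F : set X, finite_set F & \bigcup_(x in F) ball x e = [set: X].

Definition separable (T : topologicalType) : Prop :=
  exists2 D : set T, countable D & dense D.

(* The weight of [T], i.e. the least cardinality of a base, is that of [K]. *)
Definition has_weight (T : topologicalType) (K : Type) : Prop :=
  (exists2 B : set (set T), basis B & (B #= [set: K])%card) /\
  (forall B : set (set T), basis B -> ([set: K] #<= B)%card).

(* An infinite cardinal is represented by an infinite type [K]. For
   [K] of cardinality aleph_0 the class consists, by convention, of all
   separable metric spaces, including those of finite weight. *)
Definition weight_class (K : Type) (X : metricType R) : Prop :=
  (countable [set: K] /\ separable X) \/
  (~ countable [set: K] /\ has_weight X K).

Definition metrizable (Z : topologicalType) : Prop := Met Z !=set0.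

Definition complete_metric (T : Type) (d : T -> T -> R) : Prop :=
  forall u : nat -> T,
    (forall e : R, 0 < e -> exists N : nat, forall m n : nat,
       (N <= m)%N -> (N <= n)%N -> d (u m) (u n) < e) ->
    exists l : T, d (u n) l @[n --> \oo] --> (0 : R).

Definition polish (X : topologicalType) : Prop :=
  separable X /\ exists2 d, Met X d & complete_metric d.

End spaces_of_metrics.

Arguments Met R Z : clear implicits.
Arguments BMet R Z : clear implicits.
Arguments metrizable R Z : clear implicits.
Arguments polish R X : clear implicits.
Arguments supdist {R Z} d e.

(* The countable power of a discrete space, of any infinite cardinality. *)
Definition baire_space (K : choiceType) : topologicalType :=
  prod_topology (fun _ : nat => discrete_topology K).

Definition hilbert_cube (R : realType) : topologicalType :=
  prod_topology (fun _ : nat => set_type `[(0 : R), 1]).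

Section ell2.
Context {R : realType} {K : choiceType}.

Definition sqsum (f : K -> R) : \bar R := \esum_(k in [set: K]) (f k ^+ 2)%:E.

(* For infinite [K], the real Hilbert space with an orthonormal basis indexed
   by [K], which is the Hilbert space of weight the cardinal of [K]. Only its
   norm metric is given, since spaces of metrics depend on the topology only. *)
Record ell2 : Type := Ell2 { ell2_fun :> K -> R ; _ : (sqsum ell2_fun < +oo)%E }.

HB.instance Definition _ := gen_eqMixin ell2.
HB.instance Definition _ := gen_choiceMixin ell2.

Lemma ell2_ext (f g : ell2) : ell2_fun f = ell2_fun g -> f = g.
Proof.
case: f g => [f hf] [g hg] /= fg; rewrite -fg in hg *.
by congr Ell2; exact: Prop_irrelevance.
Qed.

Lemma sqsum_ge0 (f : K -> R) : (0 <= sqsum f)%E.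
Proof. by apply: esum_ge0 => k _; rewrite lee_fin sqr_ge0. Qed.

Lemma sqsumZ_le (c : R) (f : K -> R) : 0 <= c ->
  (\esum_(k in [set: K]) (c%:E * (f k ^+ 2)%:E) <= c%:E * sqsum f)%E.
Proof.
move=> c0; apply: ge_ereal_sup => _ [A [finA _] <-].
rewrite -ge0_mule_fsumr; last by move=> k; rewrite lee_fin sqr_ge0.
by rewrite lee_wpmul2l ?lee_fin//; apply: ereal_sup_ubound; exists A.
Qed.

Lemma sqsumD_le (t : R) (f g : K -> R) : 0 < t ->
  (sqsum (f \+ g)%R <= (1 + t)%:E * sqsum f + (1 + t^-1)%:E * sqsum g)%E.
Proof.
move=> t0; have ti0 : 0 < t^-1 by rewrite invr_gt0.
have h1 : 0 <= 1 + t by rewrite addr_ge0// ltW.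
have h2 : 0 <= 1 + t^-1 by rewrite addr_ge0// ltW.
apply: le_trans (leeD (sqsumZ_le f h1) (sqsumZ_le g h2)).
rewrite -esumD; try by move=> k _; rewrite mule_ge0// lee_fin// sqr_ge0.
apply: le_esum => k _; rewrite -!EFinM -EFinD lee_fin -subr_ge0.
have -> : (1 + t) * f k ^+ 2 + (1 + t^-1) * g k ^+ 2 - (f \+ g)%R k ^+ 2 =
    t * (f k - t^-1 * g k) ^+ 2.
  by rewrite /=; field; rewrite gt_eqF.
by rewrite mulr_ge0 ?sqr_ge0// ltW.
Qed.

Lemma sqsumN (f : K -> R) : sqsum (\- f) = sqsum f.
Proof. by apply: eq_esum => k _; rewrite /= sqrrN. Qed.

Lemma sqsumD_lty (f g : K -> R) :
  (sqsum f < +oo -> sqsum g < +oo -> sqsum (f \+ g)%R < +oo)%E.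
Proof.
move=> fy gy; apply: le_lt_trans (sqsumD_le f g ltr01) _.
by rewrite lte_add_pinfty// lte_mul_pinfty// lee_fin ?invr1 addr_ge0.
Qed.

Definition l2norm (f : K -> R) : R := Num.sqrt (fine (sqsum f)).

Lemma l2normN (f : K -> R) : l2norm (\- f) = l2norm f.
Proof. by rewrite /l2norm sqsumN. Qed.

Lemma sqsumE (f : K -> R) : (sqsum f < +oo)%E -> sqsum f = (l2norm f ^+ 2)%:E.
Proof.
move=> fy; rewrite /l2norm sqr_sqrtr ?fine_ge0 ?sqsum_ge0// fineK//.
by rewrite ge0_fin_numE ?sqsum_ge0.
Qed.

Lemma l2norm_eq0 (f : K -> R) : (sqsum f < +oo)%E -> l2norm f = 0 ->
  forall k, f k = 0.
Proof.
move=> fy f0 k; have := sqsumE fy; rewrite f0 expr0n /= => s0.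
have : (\esum_(i in [set k]) (f i ^+ 2)%:E <= 0)%E.
  rewrite -[leRHS]s0 esum_mkcond; apply: le_esum => i _.
  by case: ifPn => // _; rewrite lee_fin sqr_ge0.
rewrite esum_set1 ?lee_fin ?sqr_ge0// => h.
by apply/eqP; rewrite -sqrf_eq0 eq_le h sqr_ge0.
Qed.

Lemma l2normD (f g : K -> R) : (sqsum f < +oo)%E -> (sqsum g < +oo)%E ->
  l2norm (f \+ g) <= l2norm f + l2norm g.
Proof.
move=> fy gy; have fgy := sqsumD_lty fy gy.
have a0 : 0 <= l2norm f by exact: sqrtr_ge0.
have b0 : 0 <= l2norm g by exact: sqrtr_ge0.
apply/ler_addgt0Pl => e e0.
set a := l2norm f + e / 2; set b := l2norm g + e / 2.
have e20 : 0 < e / 2 by rewrite divr_gt0.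
have a1 : 0 < a by rewrite ltr_wpDl.
have b1 : 0 < b by rewrite ltr_wpDl.
have -> : e + (l2norm f + l2norm g) = a + b by rewrite /a /b; field.
rewrite -(@ler_pXn2r _ 2)// ?nnegrE ?sqrtr_ge0 ?(ltW (addr_gt0 a1 b1))//.
have := sqsumD_le f g (divr_gt0 b1 a1).
rewrite (sqsumE fgy) (sqsumE fy) (sqsumE gy).
rewrite -!EFinM -EFinD lee_fin => /le_trans; apply.
have -> : (a + b) ^+ 2 = (1 + b / a) * a ^+ 2 + (1 + (b / a)^-1) * b ^+ 2.
  by field; rewrite !gt_eqF.
have ba : 0 < b / a by rewrite divr_gt0.
apply: lerD; apply: ler_wpM2l.
- by rewrite addr_ge0// ltW.
- by rewrite ler_pXn2r// ?nnegrE ?(ltW a1)// lerDl ltW.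
- by rewrite addr_ge0// invr_ge0 ltW.
- by rewrite ler_pXn2r// ?nnegrE ?(ltW b1)// lerDl ltW.
Qed.

Definition ell2_dist (f g : ell2) : R := l2norm (f \- g).

Lemma ell2_lty (f : ell2) : (sqsum f < +oo)%E. Proof. by case: f. Qed.

Lemma ell2B_lty (f g : ell2) : (sqsum (f \- g)%R < +oo)%E.
Proof. by apply: sqsumD_lty; rewrite ?sqsumN; exact: ell2_lty. Qed.

Lemma ell2_distxx f : ell2_dist f f = 0.
Proof.
rewrite /ell2_dist /l2norm /sqsum esum1 ?sqrtr0// => k _.
by rewrite /= subrr expr0n.
Qed.

Lemma ell2_dist_positivity f g : ell2_dist f g = 0 -> f = g.
Proof.
move=> /(l2norm_eq0 (ell2B_lty f g)) fg; apply: ell2_ext; apply/funext => k.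
by apply/eqP; rewrite -subr_eq0; apply/eqP/fg.
Qed.

Lemma ell2_dist_sym f g : ell2_dist f g = ell2_dist g f.
Proof.
rewrite /ell2_dist -l2normN; congr l2norm.
by apply/funext => k /=; rewrite opprB.
Qed.

Lemma ell2_dist_triangle g f h :
  ell2_dist f h <= ell2_dist f g + ell2_dist g h.
Proof.
apply: le_trans (l2normD (ell2B_lty f g) (ell2B_lty g h)).
rewrite (_ : (f \- g) \+ (g \- h) = f \- h)//; apply/funext => k /=.
by rewrite addrA subrK.
Qed.

HB.instance Definition _ := isMetric.Build R ell2
  ell2_distxx ell2_dist_positivity ell2_dist_sym ell2_dist_triangle.

End ell2.
Arguments ell2 R K : clear implicits.

(* Main.v *)
(* If h : X -> Z -> R is continuous in z, 1/2-Lipschitz in x, and for a in a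
   dense subset of X some u, v in Z satisfy h(-, u) = d(-, a) / 2 and
   h(-, v) = - d(-, a) / 2, then mapping x to the metric
   d_Z(z, w) + |h(x, z) - h(x, w)| embeds X isometrically into Met(Z): the
   difference of the metrics of x and y is at most d(x, y) everywhere, and equals
   |d(x, a) - d(y, a)| at the pair (u, v).
   For l^2(K) and B(K) the points u, v can be taken in a uniformly discrete set,
   resp. in the blocks of a clopen partition. For the other spaces Z, let c_i be
   continuous functions on Z taking every 0-1 sequence as value; the parameters
   c_i(z) then drive a bisection procedure producing every bounded 1/2-Lipschitz
   function on X, which defines h(-, z). Such c_i are the coordinates of the
   Hilbert cube; on an uncountable Polish space they come from a Cantor scheme of
   balls centred at condensation points. *)

Require Import Defs.
From mathcomp Require Import all_boot all_order all_algebra.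
From mathcomp Require Import all_classical all_reals all_analysis.
From mathcomp Require Import ring lra zify.
Import Order.TTheory GRing.Theory Num.Theory.
Import numFieldNormedType.Exports.
Local Open Scope classical_set_scope.
Local Open Scope ring_scope.

Set Implicit Arguments.
Unset Strict Implicit.
Unset Printing Implicit Defensive.

(** * Metrics generating a topology *)

Section metrics.
Context {R : realType}.

Lemma is_metric_ge0 (T : Type) (d : T -> T -> R) : is_metric d ->
  forall x y, 0 <= d x y.
Proof.
move=> [d0 _ dC dT] x y; have := dT x y x; rewrite d0 (dC y x) => h; lra.
Qed.

Lemma is_metric_mdist (X : metricType R) : is_metric (@mdist R X).
Proof.
by split; [exact: mdistxx|exact: mdist_positivity|exact: metric_sym|
  exact: metric_triangle].
Qed.

Lemma Met_mdist (X : metricType R) : Met R X (@mdist R X).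
Proof.
split; first exact: is_metric_mdist.
move=> x; rewrite -nbhs_ballE /nbhs_ball; congr (nbhs_ball_ _ x).
by apply/funext => y; apply/funext => r; rewrite ballEmdist.
Qed.

Lemma MetP (Z : topologicalType) (d : Z -> Z -> R) : Met R Z d <->
  is_metric d /\ forall z (P : set Z),
    nbhs z P <-> exists2 r : R, 0 < r & forall y, d z y < r -> P y.
Proof.
split=> [[dm dn]|[dm dn]]; split=> // z.
  by move=> P; rewrite dn.
by apply/seteqP; split => P /dn.
Qed.

Lemma Met_nbhs (Z : topologicalType) (d : Z -> Z -> R) z (r : R) :
  Met R Z d -> 0 < r -> nbhs z [set y | d z y < r].
Proof. by move=> /MetP[_ dn] r0; apply/dn; exists r. Qed.

(** The added term is a continuous pseudometric: the sum dominates [d], and continuity of [h] at [z]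
    keeps the term small near [z], so neighbourhoods do not change. *)
Lemma Met_add (Z : topologicalType) (d : Z -> Z -> R) (h : Z -> R) :
  Met R Z d -> continuous h -> Met R Z (fun u v => d u v + `|h u - h v|).
Proof.
move=> /MetP[dm dn] hc; have d_ge0 := is_metric_ge0 dm.
case: dm => d0 ds dC dT; apply/MetP; split; first split.
- by move=> x; rewrite d0 subrr normr0 addr0.
- move=> x y e; apply: ds; apply/eqP; rewrite eq_le d_ge0 andbT.
  by rewrite -e lerDl.
- by move=> x y; rewrite dC distrC.
- move=> x y z; rewrite addrACA lerD// (le_trans _ (ler_normD _ _))//.
  by rewrite addrA subrK.
move=> z P; split=> [/dn[r r0 rP]|[r r0 rP]].
  by exists r => // y zy; apply: rP; rewrite (le_lt_trans _ zy)// lerDl.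
have r20 : 0 < r / 2 by rewrite divr_gt0.
have /cvgrPdist_lt/(_ _ r20) := hc z.
have zr : nbhs z [set y | d z y < r / 2] by apply/dn; exists (r / 2).
move=> /(filterI zr); apply: filterS => y -[/= dy hy]; apply: rP.
by rewrite (splitr r) ltrD.
Qed.

Lemma Met_minr1 (Z : topologicalType) (d : Z -> Z -> R) :
  Met R Z d -> Met R Z (fun u v => Num.min (d u v) 1).
Proof.
move=> /MetP[dm dn]; have d_ge0 := is_metric_ge0 dm.
case: dm => d0 ds dC dT; apply/MetP; split; first split.
- by move=> x; rewrite d0 min_l.
- move=> x y; case: leP => [_ /ds//|_ /eqP]; by rewrite oner_eq0.
- by move=> x y; rewrite dC.
- move=> x y z; have := dT x y z; have := d_ge0 x y; have := d_ge0 y z.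
  by case: (leP (d x z) 1); case: (leP (d x y) 1);
    case: (leP (d y z) 1) => *; lra.
move=> z P; split=> [/dn[r r0 rP]|[r r0 rP]].
  exists (Num.min r 1); first by rewrite lt_min r0 ltr01.
  move=> y; rewrite lt_min !gt_min => /andP[/orP[/rP//|r1]].
  by rewrite ltxx orbF => y1; apply: rP; lra.
apply/dn; exists r => // y zy; apply: rP; by rewrite gt_min zy.
Qed.

Lemma metrizable_BMet (Z : topologicalType) : metrizable R Z ->
  BMet R Z !=set0.
Proof.
move=> [d dM]; exists (fun u v => Num.min (d u v) 1).
by split; [exact: Met_minr1|exists 1 => x y; rewrite ge_min lexx orbT].
Qed.

End metrics.

(** * Isometric embeddings from half-Lipschitz families *)

Definition half_lipschitz_family {R : realType} (X : metricType R)
    (Z : topologicalType) (h : X -> Z -> R) : Prop :=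
  [/\ forall x, continuous (h x),
      forall x y z, `|h x z - h y z| <= mdist x y / 2
    & forall (x : X) (e : R), 0 < e -> exists a u v, [/\ mdist x a < e,
        forall y, h y u = mdist y a / 2 & forall y, h y v = - (mdist y a / 2)]].

Section embedding.
Context {R : realType} (X : metricType R) (Z : topologicalType).
Variables (d : Z -> Z -> R) (h : X -> Z -> R).
Hypothesis h_family : half_lipschitz_family h.

Let e x u v := d u v + `|h x u - h x v|.

Lemma supdist_embedding x y : supdist (e x) (e y) = (mdist x y)%:E.
Proof.
have [_ hl hd] := h_family.
apply/eqP; rewrite eq_le; apply/andP; split.
  rewrite /supdist ge_max lee_fin mdist_ge0 /=; apply: ge_ereal_sup.
  move=> _ [[u v] _ <-] /=; rewrite lee_fin /e.
  have -> : d u v + `|h x u - h x v| - (d u v + `|h y u - h y v|) =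
    `|h x u - h x v| - `|h y u - h y v| by ring.
  apply: (le_trans (ler_dist_dist _ _)).
  have -> : h x u - h x v - (h y u - h y v) =
    (h x u - h y u) - (h x v - h y v) by ring.
  rewrite (le_trans (ler_normB _ _))// [leRHS](splitr (mdist x y)).
  by rewrite lerD.
(* For [a] within [r / 2] of [x], the metrics at [(u, v)] differ by |d(x, a) - d(y, a)|, which is at
   least d(x, y) - 2 d(x, a) > d(x, y) - [r]. *)
apply/lee_addgt0Pr => r r0.
have [a [u [v [xa hu hv]]]] := hd x (r / 2) (divr_gt0 r0 (ltr0Sn _ 1)).
have : (`|e x u v - e y u v|%:E <= supdist (e x) (e y))%E.
  by rewrite le_max ereal_sup_ubound ?orbT//; exists (u, v).
move=> /(leeD2r r%:E)/(le_trans _); apply.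
rewrite -EFinD lee_fin /e !hu !hv.
have ge0 z : 0 <= mdist z a by exact: mdist_ge0.
 rewrite !opprK -!splitr !(ger0_norm (ge0 _)).
have := metric_triangle x a y; rewrite (metric_sym a y) => t.
rewrite -lerBlDr ler_normr; apply/orP; right; lra.
Qed.

End embedding.

(** * Universality criteria and dense families indexed by a cardinal *)

Section weight.
Context {R : realType}.

Lemma universal_Met (Z : topologicalType) (C : metricType R -> Prop) :
  metrizable R Z ->
  (forall X : metricType R, C X -> X ->
    exists h : X -> Z -> R, half_lipschitz_family h) ->
  universal (Met R Z) supdist C.
Proof.
move=> [d dM] H X CX.
(* The empty space has no point to serve as a default when a dense family is chosen, so it is
   treated apart; any constant map embeds it. *)
have [X0|/existsNP[x0 _]] := pselect (forall x : X, False).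
  by exists (fun=> d); split => x; have := X0 x.
have [h hP] := H X CX x0.
exists (fun x u v => d u v + `|h x u - h x v|); split=> [x|x y].
  by apply: Met_add => //; case: hP.
exact: supdist_embedding.
Qed.

Lemma universal_BMet (Z : topologicalType) (C : metricType R -> Prop) :
  metrizable R Z ->
  (forall X : metricType R, C X -> X -> exists2 h : X -> Z -> R,
    half_lipschitz_family h & forall x, exists M, forall z, `|h x z| <= M) ->
  universal (BMet R Z) supdist C.
Proof.
move=> /metrizable_BMet[d [dM [D dD]]] H X CX.
have [X0|/existsNP[x0 _]] := pselect (forall x : X, False).
  by exists (fun=> d); split => x; have := X0 x.
have [h hP hb] := H X CX x0.
exists (fun x u v => d u v + `|h x u - h x v|); split=> [x|x y].
  split; first by apply: Met_add => //; case: hP.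
  have [M hM] := hb x; exists (D + (M + M)) => u v.
  by rewrite lerD// (le_trans (ler_normB _ _))// lerD.
exact: supdist_embedding.
Qed.

Definition dense_range (X : metricType R) (I : Type) (a : I -> X) : Prop :=
  forall x (e : R), 0 < e -> exists i, mdist x (a i) < e.

(** An injection of [B] into [K] codes the members of [B]; [a k] is a point of the set coded by [k],
    and [x0] if there is none. [B] can be a base, or the singletons of a dense set. *)
Lemma dense_range_base (X : metricType R) (x0 : X) (K : Type)
    (B : set (set X)) :
  (forall x (e : R), 0 < e ->
    exists2 U, B U & U !=set0 /\ U `<=` [set y | mdist x y < e]) ->
  (B #<= [set: K])%card -> exists a : K -> X, dense_range a.
Proof.
move=> Bb /card_leP[f].
pose g (U : set X) (BU : U \in B) : K := val (f (SigSub BU)).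
have gI U V BU BV : @g U BU = @g V BV -> U = V.
  move=> /val_inj /(@inj _ _ _ f) => UV.
  by have /(congr1 val) := UV (mem_setT _) (mem_setT _).
pose a k := xget x0 [set x | exists U BU, @g U BU = k /\ U x].
exists a => x e e0; have [U BU [[y Uy] Ue]] := Bb x e e0.
exists (g U (mem_set BU)); apply: Ue.
rewrite /a; case: xgetP => [z _ [V [BV [/gI <- //]]]|/(_ y) []].
by exists U, (mem_set BU).
Qed.

Lemma separable_dense_range (X : metricType R) (x0 : X) (K : Type) :
  separable X -> infinite_set [set: K] -> exists a : K -> X, dense_range a.
Proof.
move=> [D cD dD] /infiniteP iK.
apply: (@dense_range_base X x0 K [set [set x] | x in D]).
  move=> x e e0.
  have [||y [+ Dy]] := dD (ball x e)^°.
  - by exists x; apply: nbhs_singleton; apply: nbhs_interior; apply: nbhsx_ballx.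
  - exact: open_interior.
  move=> /interior_subset; rewrite ballEmdist => xy.
  by exists [set y]; [exists y|split=> [|_ ->//]; exists y].
exact: card_le_trans (card_image_le _ _) (card_le_trans cD iK).
Qed.

Lemma weight_class_dense_range (X : metricType R) (x0 : X) (K : Type) :
  infinite_set [set: K] -> weight_class K X ->
  exists a : K -> X, dense_range a.
Proof.
move=> iK [[_ sX]|[_ [[B [Bo Bb] BK] _]]].
  exact: separable_dense_range.
apply: (@dense_range_base X x0 K B).
  move=> x e e0; have [U [BU Ux] /=] := Bb x _ (nbhsx_ballx x _ e0).
  by rewrite ballEmdist => Ue; exists U => //; split=> //; exists x.
by move: BK; rewrite card_eq_le => /andP[].
Qed.

End weight.

(** * Metrizability of countable products *)

Section products.
Context {R : realType}.

Lemma exists_invS_lt (r : R) : 0 < r -> exists n : nat, n.+1%:R^-1 < r.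
Proof.
move=> r0; have [N _ /(_ N (leqnn N))] := near_infty_natSinv_lt (PosNum r0).
by exists N.
Qed.

Section product_metric.
Variables (T : nat -> topologicalType) (d : forall n, T n -> T n -> R).
Hypothesis dM : forall n, Met R (T n) (@d n).

(** Truncating the [n]-th coordinate distance at 1/(n+1) leaves only finitely many coordinates
    relevant at any given scale, so the supremum [D] generates the product topology. *)
Let t (f g : prod_topology T) n := Num.min (d (f n) (g n)) n.+1%:R^-1.
Let D f g := sup (range (t f g)).

Let dm n := (dM n).1.
Let d_ge0 n x y := is_metric_ge0 (dm n) x y.

Let t_ge0 f g n : 0 <= t f g n.
Proof. by rewrite /t le_min d_ge0 invr_ge0 ler0n. Qed.

Let t_ub f g : ubound (range (t f g)) 1.
Proof. by move=> _ [n _ <-]; rewrite /t ge_min invf_le1 ?ler1n ?ltr0Sn ?orbT. Qed.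

Let t_le f g n : t f g n <= D f g.
Proof. by apply: ub_le_sup; [exists 1; exact: t_ub|exists n]. Qed.

Let D_le f g r : (forall n, t f g n <= r) -> D f g <= r.
Proof. by move=> h; apply: ge_sup => [|_ [n _ <-]//]; exists (t f g 0), 0%N. Qed.

Lemma prod_metrizable : metrizable R (prod_topology T).
Proof.
exists D; apply/MetP; split; first split.
- move=> f; apply/eqP; rewrite eq_le (le_trans (t_ge0 f f 0) (t_le _ _ _)) andbT.
  by apply: D_le => n; have [d0 _ _ _] := dm n; rewrite /t d0 ge_min lexx.
- move=> f g fg; apply: functional_extensionality_dep => n.
  have [_ ds _ _] := dm n; apply: ds.
  apply/eqP; rewrite eq_le d_ge0 andbT.
  have := t_le f g n; rewrite fg ge_min => /orP[//|].
  by rewrite leNgt invr_gt0 ltr0Sn.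
- move=> f g; rewrite /D (_ : t f g = t g f)//; apply/funext => n.
  by have [_ _ dC _] := dm n; rewrite /t dC.
- move=> f g h; apply: D_le => n.
  apply: le_trans (lerD (t_le f g n) (t_le g h n)).
  have [_ _ _ /(_ (f n) (g n) (h n))] := dm n; rewrite /t.
  have := d_ge0 (f n) (g n); have := d_ge0 (g n) (h n).
  have : 0 < n.+1%:R^-1 :> R by rewrite invr_gt0.
  move: (d _ _) (d _ _) (d _ _) (n.+1%:R^-1) => a b c i.
  by case: (leP b i); case: (leP c i); case: (leP a i) => *; lra.
move=> f P; split=> [|[r r0 rP]].
  (* The sets containing a [D]-ball about [f] form a filter. The product topology is the supremum of
     the topologies induced by the projections, so it suffices to treat one coordinate at a time. *)
  pose F : set (set (prod_topology T)) := 
    [set Q | exists2 r : R, 0 < r & forall g, D f g < r -> Q g].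
  have FF : Filter F.
    split=> [|A B [r r0 rA] [s s0 sB]|A B AB [r r0 rA]]; first by exists 1.
    - exists (Num.min r s); first by rewrite lt_min r0.
      by move=> g; rewrite lt_min => /andP[/rA ? /sB].
    - by exists r => // g /rA /AB.
  suff : cvg_to F (nbhs f) by apply.
  apply/cvg_sup => n Q [_ [[B oB <-] /= Bf BQ]].
  have [_ /(_ (f n) B)[+ _]] := (MetP _).1 (dM n).
  case=> [|r r0 rB]; first exact: open_nbhs_nbhs.
  exists (Num.min r n.+1%:R^-1); first by rewrite lt_min r0 invr_gt0 ltr0Sn.
  move=> g fg; apply: BQ; apply: rB.
  have := le_lt_trans (t_le f g n) fg.
  by rewrite lt_min !gt_min ltxx orbF => /andP[/orP[//|h1] h]; exact: lt_trans h h1.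
have r20 : 0 < r / 2 by rewrite divr_gt0.
(* Coordinates beyond [N] contribute less than [r / 2] by truncation; the first [N.+1] are
   controlled by a finite intersection of neighbourhoods. *)
have [N Nr] := exists_invS_lt r20.
have : nbhs f
    [set g : prod_topology T | forall i : 'I_N.+1, d (f i) (g i) < r / 2].
  have near_f (i : 'I_N.+1) :
      nbhs f [set g : prod_topology T | d (f i) (g i) < r / 2].
    exact: (@proj_continuous nat T i f _ (Met_nbhs (f i) (dM i) r20)).
  exact: (@filter_forall (prod_topology T) _ _ (nbhs f) _ near_f).
apply: filterS => g fg; apply: rP.
apply: (@le_lt_trans _ _ (r / 2)); last lra.
apply: D_le => n; rewrite ge_min; have [nN|Nn] := ltnP n N.+1.
  by rewrite (ltW (fg (Ordinal nN))).
apply/orP; right; apply: le_trans (ltW Nr).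
by rewrite lef_pV2 ?posrE ?ltr0Sn// ler_nat ltnW.
Qed.

End product_metric.

Lemma Met_discrete (T : discreteTopologicalType) :
  Met R T (fun x y => (x != y)%:R).
Proof.
apply/MetP; split; first split.
- by move=> x; rewrite eqxx.
- by move=> x y; case: eqVneq => // _ /eqP; rewrite oner_eq0.
- by move=> x y; rewrite eq_sym.
- move=> x y z; have [->|xy] := eqVneq x y; first by rewrite add0r.
  by rewrite -natrD ler_nat (leq_trans (leq_b1 _)) ?leq_addr.
move=> z P; split=> [/nbhs_singleton Pz|[r r0 rP]].
  by exists 1 => // y; case: eqVneq => [<-//|_]; rewrite ltxx.
apply: filterS (discrete_set1 z) => _ ->; apply: rP.
by rewrite eqxx.
Qed.

Lemma Met_subspace (X : metricType R) (A : set X) :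
  Met R (set_type A) (fun x y => mdist (val x) (val y)).
Proof.
apply/MetP; split; first split.
- by move=> x; rewrite mdistxx.
- by move=> x y /mdist_positivity/val_inj.
- by move=> x y; rewrite metric_sym.
- by move=> x y z; exact: metric_triangle.
move=> z P; split=> [[_ [[B oB <-] /= Bz BP]]|[r r0 rP]].
  have [_ /(_ (val z) B)[+ _]] := (MetP _).1 (Met_mdist X).
  case=> [|r r0 rB]; first exact: open_nbhs_nbhs.
  by exists r => // y zy; apply: BP; apply: rB.
have zr : nbhs z (@set_val X A @^-1` [set y | mdist (val z) y < r]).
  by apply: initial_continuous; exact: Met_nbhs (Met_mdist X) r0.
exact: filterS zr.
Qed.

Lemma baire_metrizable (K : choiceType) : metrizable R (baire_space K).
Proof. by apply: prod_metrizable => n; exact: Met_discrete. Qed.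

Lemma cantor_metrizable : metrizable R cantor_space.
Proof. by apply: prod_metrizable => n; exact: Met_discrete. Qed.

Lemma hilbert_cube_metrizable : metrizable R (hilbert_cube R).
Proof. by apply: prod_metrizable => n; exact: (@Met_subspace R^o). Qed.

End products.

(** * The Baire space and the Hilbert space *)

Section families.
Context {R : realType}.

Lemma mdist_distl (X : metricType R) (x y a : X) :
  `|mdist x a - mdist y a| <= mdist x y.
Proof.
have := metric_triangle x y a; have := metric_triangle y x a.
by rewrite ler_norml (metric_sym y x) => *; lra.
Qed.

Lemma locally_lipschitz_continuous (Z : topologicalType) (d : Z -> Z -> R)
    (f : Z -> R) : Met R Z d ->
  (forall z, exists r C : R, 0 < r /\
    forall y, d z y < r -> `|f z - f y| <= C * d z y) ->
  continuous f.
Proof.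
move=> dM fl z; apply/cvgrPdist_lt => e e0.
have [r [C [r0 rC]]] := fl z.
have s0 : 0 < e / (`|C| + 1) by rewrite divr_gt0// ltr_wpDl.
apply: filterS (filterI (Met_nbhs z dM r0) (Met_nbhs z dM s0)).
move=> y [/= /rC /le_lt_trans + zy]; apply.
rewrite (@le_lt_trans _ _ ((`|C| + 1) * d z y))//.
  by rewrite ler_wpM2r ?(is_metric_ge0 dM.1)// (le_trans (ler_norm _))// lerDl.
by rewrite mulrC -ltr_pdivlMr// ltr_wpDl.
Qed.

Lemma max0_lipschitz (a b : R) : `|Num.max 0 a - Num.max 0 b| <= `|a - b|.
Proof.
rewrite ler_norml; have := ler_norm (a - b); have := ler_norm (b - a).
have := normr_ge0 (a - b).
by rewrite distrC; case: (leP 0 a); case: (leP 0 b) => *; apply/andP; split; lra.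
Qed.

(** Each [u i] carries a tent function of height 1 and radius [e / 4]. Separation makes the supports
    disjoint, so at every point [h] is a single multiple of some [c x i], however large the values
    of [c] are. *)
Lemma separated_extension (Z : topologicalType) (d : Z -> Z -> R) (I X : Type)
    (u : I -> Z) (e : R) (c : X -> I -> R) :
  Met R Z d -> 0 < e -> (forall i j, d (u i) (u j) < e -> i = j) ->
  exists h : X -> Z -> R, [/\ forall x, continuous (h x),
    forall x i, h x (u i) = c x i &
    forall z, (forall x, h x z = 0) \/
      exists i (t : R), 0 <= t <= 1 /\ forall x, h x z = t * c x i].
Proof.
move=> dM e0 sep; have d_ge0 := is_metric_ge0 dM.1.
have [d0 _ dC dT] := dM.1.
pose b z i := Num.max 0 (1 - 4 / e * d z (u i)).
pose near_u z := exists i, d z (u i) < e / 4.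
pose h x z := if pselect (near_u z) is left p then
  let i := projT1 (cid p) in b z i * c x i else 0.
have ie0 : 0 < 4 / e by rewrite divr_gt0.
(* If [y] is also near [u j], then [u i] and [u j] are closer than e/2 + e/4 + e/4 = e, hence
   [i = j]; if [y] is near no centre, its tent value at [i] is 0. *)
have hE x z i : d z (u i) < e / 2 -> forall y, d z y < e / 4 ->
    h x y = b y i * c x i.
  move=> zi y zy; rewrite /h; case: pselect => [p|np] /=.
    case: cid => j /= yj; congr (b y _ * c x _); apply/esym/sep;
    have := dT (u i) z (u j); have := dT z y (u j); rewrite (dC (u i) z); lra.
  rewrite /b max_l ?mul0r// subr_le0 -ler_pdivrMl// mulr1 invf_div.
  by rewrite leNgt; apply/negP => yi; apply: np; exists i.
exists h; split.
- move=> x; apply: (locally_lipschitz_continuous dM) => z.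
  have e40 : 0 < e / 4 by rewrite divr_gt0.
  have [[i zi]|nz] := pselect (exists i, d z (u i) < e / 2).
    exists (e / 4), (4 / e * `|c x i|); split=> // y zy.
    rewrite !(hE x z i)// ?d0// -mulrBl normrM mulrAC ler_wpM2r//.
    rewrite (le_trans (max0_lipschitz _ _))//.
    rewrite opprB addrC addrA subrK -mulrBr normrM (gtr0_norm ie0).
    rewrite ler_pM2l// ler_norml.
    have := dT z y (u i); have := dT y z (u i); rewrite (dC y z) => *; lra.
  (* No centre lies within [e / 2] of [z], so no tent reaches the ball of radius [e / 4] about [z],
     and [h x] vanishes there. *)
  exists (e / 4), 0; split=> // y zy; rewrite mul0r /h.
  have nearF w : d z w < e / 4 -> near_u w -> False.
    move=> zw [i wi]; apply: nz; exists i; have := dT z w (u i); lra.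
  case: pselect => [/nearF[]|_]; first by rewrite d0.
  by case: pselect => [/nearF[]//|_]; rewrite subrr normr0.
- move=> x i; rewrite (hE x (u i) i) ?d0 ?divr_gt0//.
  by rewrite /b d0 mulr0 subr0 max_r// mul1r.
move=> z; rewrite /h; case: pselect => [p|np]; last by left.
right; exists (projT1 (cid p)), (b z (projT1 (cid p))); split=> //.
rewrite /b le_max lexx ge_max ler01 /= gerBl mulr_ge0// ltW//.
Qed.

Lemma sgn_half_lipschitz (X : metricType R) (x y a : X) (t : R) : `|t| <= 1 ->
  `|t * (mdist x a / 2) - t * (mdist y a / 2)| <= mdist x y / 2.
Proof.
move=> t1; rewrite -mulrBr -mulrBl mulrA normrM normfV normr_nat.
rewrite ler_pM2r ?invr_gt0// normrM -[leRHS]mul1r ler_pM//.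
exact: mdist_distl.
Qed.

Lemma infinite_set_neq (K : Type) : infinite_set [set: K] ->
  exists k l : K, k <> l.
Proof.
move=> /infiniteP/card_leP[f].
exists (val (f (SigSub (mem_setT 0%N)))), (val (f (SigSub (mem_setT 1%N)))).
move=> /val_inj.
by move=> /(@inj _ _ _ f (SigSub _) (SigSub _) (mem_setT _) (mem_setT _)).
Qed.

Lemma locally_constant_continuous (Z : topologicalType) (f : Z -> R) :
  (forall z, nbhs z [set y | f y = f z]) -> continuous f.
Proof.
move=> fl z; apply/cvgrPdist_lt => e e0; apply: filterS (fl z) => y /= ->.
by rewrite subrr normr0.
Qed.

Lemma prod_topology_nbhs (T : nat -> topologicalType) (z : prod_topology T)
    (n : nat) (P : set (T n)) :
  nbhs (z n) P -> nbhs z [set y : prod_topology T | P (y n)].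
Proof. by move=> zP; exact: (@proj_continuous nat T n z _ zP). Qed.

Lemma baire_nbhs (K : choiceType) (z : baire_space K) (n : nat) :
  nbhs z [set y : baire_space K | y n = z n].
Proof.
exact: (@prod_topology_nbhs (fun=> discrete_topology K) z n [set z n]
  (discrete_set1 _)).
Qed.

(** Coordinate 0 of [z] selects a point of the dense family, and coordinate 1 only a sign: plus at
    [k], minus elsewhere. Depending on two discrete coordinates, [h x] is locally constant. *)
Lemma baire_family (X : metricType R) (K : choiceType) (a : K -> X) :
  infinite_set [set: K] -> dense_range a ->
  exists2 h : X -> baire_space K -> R, half_lipschitz_family h
    & forall x z, exists y, `|h x z| <= mdist x y / 2.
Proof.
move=> /infinite_set_neq[k [l kl]] ad.
pose s (i : K) : R := if i == k then 1 else -1.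
have s1 i : `|s i| = 1 by rewrite /s; case: ifP; rewrite ?normrN normr1.
pose h x (z : baire_space K) := s (z 1%N) * (mdist x (a (z 0%N)) / 2).
exists h; last first.
  move=> x z; exists (a (z 0%N)); rewrite /h normrM s1 mul1r ger0_norm//.
  by rewrite divr_ge0// mdist_ge0.
split.
- move=> x; apply: locally_constant_continuous => z.
  apply: filterS (filterI (baire_nbhs z 0) (baire_nbhs z 1)) => w [/= w0 w1].
  by rewrite /h w0 w1.
- by move=> x y z; apply: sgn_half_lipschitz; rewrite s1.
- move=> x e e0; have [i xi] := ad x e e0; exists (a i).
  exists (fun n => if n == 0%N then i else k).
  exists (fun n => if n == 0%N then i else l); split=> // y; rewrite /h /s /=.
    by rewrite eqxx mul1r.
  by case: eqP => [/esym//|_]; rewrite mulN1r.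
Qed.

Lemma ell2_coord_le (K : choiceType) (f g : ell2 R K) k :
  `|f k - g k| <= mdist f g.
Proof.
rewrite -[mdist f g]/(ell2_dist f g) -(@ler_pXn2r _ 2)// ?nnegrE ?sqrtr_ge0//.
rewrite real_normK ?num_real// -lee_fin -sqsumE; last exact: ell2B_lty.
rewrite /sqsum.
rewrite -[leLHS](@esum_set1 _ _ k (fun k => ((f \- g) k ^+ 2)%:E)%R); last first.
  by rewrite lee_fin sqr_ge0.
rewrite esum_mkcond; apply: le_esum => i _.
by case: ifPn => // _; rewrite lee_fin sqr_ge0.
Qed.

Lemma ell2_axis_subproof (K : choiceType) (k : K) (s : R) :
  (sqsum (fun j => if j == k then s else 0)%R < +oo)%E.
Proof.
rewrite (@le_lt_trans _ _ (\esum_(j in [set k]) (s ^+ 2)%:E)%E)//; last first.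
  by rewrite esum_set1 ?ltry// lee_fin sqr_ge0.
rewrite [leRHS]esum_mkcond; apply: le_esum => j _.
case: eqVneq => [->|_]; first by rewrite mem_set.
by rewrite expr0n; case: ifP => // _; rewrite lee_fin sqr_ge0.
Qed.

Definition ell2_axis (K : choiceType) (k : K) (s : R) : ell2 R K :=
  Ell2 (ell2_axis_subproof k s).

Lemma ell2_family (X : metricType R) (K : choiceType) (a : K -> X) :
  dense_range a ->
  exists2 h : X -> ell2 R K -> R, half_lipschitz_family h
    & forall x z, exists y, `|h x z| <= mdist x y / 2.
Proof.
move=> ad; pose s (b : bool) : R := if b then 1 else -1.
have s1 i : `|s i| = 1 by rewrite /s; case: ifP; rewrite ?normrN normr1.
pose c x (p : K * bool) := s p.2 * (mdist x (a p.1) / 2).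
pose u (p : K * bool) := ell2_axis p.1 (s p.2).
(* The centres are plus and minus the basis vectors; two distinct ones differ by at least 1 in some
   coordinate. *)
have sep p q : mdist (u p) (u q) < 1 -> p = q.
  move: p q => [i b] [j b'] /(le_lt_trans (ell2_coord_le _ _ i)) /=.
  rewrite eqxx; case: eqP => [->|_]; last by rewrite subr0 s1 ltxx.
  by rewrite /s ltr_norml; case: b; case: b' => // h; exfalso; lra.
have [h [hc hu hz]] := separated_extension c (Met_mdist (ell2 R K)) ltr01 sep.
have c2 x p : `|c x p| = mdist x (a p.1) / 2.
  by rewrite /c normrM s1 mul1r ger0_norm// divr_ge0// mdist_ge0.
exists h; last first.
  move=> x z; have [h0|[p [t [/andP[t0 t1] ht]]]] := hz z.
    by exists x; rewrite h0 normr0 mdistxx mul0r.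
  by exists (a p.1); rewrite ht normrM c2 ger0_norm// ler_piMl// -c2.
split => //.
- move=> x y z; have [h0|[p [t [/andP[t0 t1] ht]]]] := hz z.
    by rewrite !h0 subrr normr0 divr_ge0// mdist_ge0.
  rewrite !ht /c !mulrA -!(mulrA (t * _)); apply: sgn_half_lipschitz.
  by rewrite normrM s1 mulr1 ger0_norm.
- move=> x e e0; have [k xk] := ad x e e0.
  exists (a k), (u (k, true)), (u (k, false)).
  by split=> // y; rewrite hu /c /= ?mul1r ?mulN1r.
Qed.

End families.

(** * Bisection among 1/2-Lipschitz functions *)

Section sandwich.
Context {R : realType} (X : metricType R) (a : nat -> X) (M : R).
Implicit Types (LU : (X -> R) * (X -> R)) (p x y : X) (t : R) (c : nat -> R).

Definition half_lipschitz (g : X -> R) := forall x y, g x <= g y + mdist x y / 2.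

(* The parameter [t] in [0, 1] selects which half of the interval
   [LU.1 p, LU.2 p] is kept (the upper one for [t = 1]); intermediate values
   interpolate, so that the choice is continuous. *)
Definition halve p t LU : (X -> R) * (X -> R) :=
  let w := (LU.2 p - LU.1 p) / 2 in
  (fun x => Num.max (LU.1 x) (LU.1 p + t * w - mdist x p / 2),
   fun x => Num.min (LU.2 x) (LU.2 p - (1 - t) * w + mdist x p / 2)).

Definition between LU :=
  [/\ half_lipschitz LU.1, half_lipschitz LU.2 & forall x, LU.1 x <= LU.2 x].

(** The new bounds are a maximum and a minimum with cones of slope 1/2 and apex at [p], so they stay
    half-Lipschitz. They do not cross, since the apexes are still [w] apart. *)
Lemma halve_between p t LU : 0 <= t <= 1 -> between LU ->
  between (halve p t LU).
Proof.
move=> /andP[t0 t1] [Ll Ul LU_le]; set w := (LU.2 p - LU.1 p) / 2.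
have w0 : 0 <= w by rewrite divr_ge0// subr_ge0.
have tw : 0 <= t * w by rewrite mulr_ge0.
have tw1 : 0 <= (1 - t) * w by rewrite mulr_ge0// subr_ge0.
have e : t * w + (1 - t) * w = w by ring.
have we : w = (LU.2 p - LU.1 p) / 2 by [].
split=> x; rewrite /= -/w.
- move=> y; have := Ll x y; have := metric_triangle y x p.
  rewrite (metric_sym y x) => t_yp Lxy; rewrite ge_max -!lerBlDr !le_max.
  by apply/andP; split; apply/orP; [left|right]; lra.
- move=> y; have := Ul x y; have := metric_triangle x y p.
  move=> t_xp Uxy; rewrite -lerBlDr le_min !lerBlDr !ge_min.
  by apply/andP; split; apply/orP; [left|right]; lra.
rewrite ge_max !le_min LU_le /=; have := mdist_ge0 x p.
have := Ll x p; have := Ul p x; rewrite (metric_sym p x) => *.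
by apply/and3P; split; lra.
Qed.

Lemma halve_le p t LU x :
  LU.1 x <= (halve p t LU).1 x /\ (halve p t LU).2 x <= LU.2 x.
Proof. by rewrite /= le_max ge_min !lexx. Qed.

(** The lower apex rises by [t * w] and the upper one drops by [(1 - t) * w]: the gap closes by [w],
    half of it, whatever [t] is. *)
Lemma halve_width p t LU :
  (halve p t LU).2 p - (halve p t LU).1 p <= (LU.2 p - LU.1 p) / 2.
Proof.
rewrite /= mdistxx mul0r subr0 addr0.
set w := (LU.2 p - LU.1 p) / 2.
rewrite (@le_trans _ _ ((LU.2 p - (1 - t) * w) - (LU.1 p + t * w)))//.
  by rewrite lerB// ?ge_min ?le_max lexx orbT.
have -> : LU.2 p - (1 - t) * w - (LU.1 p + t * w) = LU.2 p - LU.1 p - w by ring.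
by rewrite /w; lra.
Qed.

Definition upper_half (g : X -> R) p LU : bool := (LU.1 p + LU.2 p) / 2 <= g p.

(** The bit compares [g p] with the midpoint, so [g p] lies between the new apexes; being
    half-Lipschitz, [g] then respects both cones everywhere. *)
Lemma halve_target p t LU (g : X -> R) : half_lipschitz g ->
  (forall x, LU.1 x <= g x <= LU.2 x) ->
  t = (upper_half g p LU)%:R ->
  forall x, (halve p t LU).1 x <= g x <= (halve p t LU).2 x.
Proof.
move=> gl gLU ht x; rewrite /= ge_max le_min.
have := gLU x; have := gLU p; have := gl x p; have := gl p x.
rewrite (metric_sym p x) ht /upper_half.
case: (leP (_ / _) (g p)) => hm; rewrite /= ?mulr1n ?mulr0n => *;
  rewrite -andbA; apply/and4P; split; lra.
Qed.

Fixpoint sandwich c n : (X -> R) * (X -> R) :=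
  if n is n'.+1 then halve (a n') (c n') (sandwich c n')
  else (fun=> - M, fun=> M).

Hypothesis M0 : 0 <= M.

Let unit c := forall n, 0 <= c n <= 1.

Lemma sandwich_between c n : unit c -> between (sandwich c n).
Proof.
move=> c1; elim: n => [|n IH] /=; last exact: halve_between.
by split=> [x y|x y|x] /=; rewrite ?lerDl ?divr_ge0 ?mdist_ge0// ge0_cp.
Qed.

Lemma sandwich_mono c m n x : (m <= n)%N ->
  (sandwich c m).1 x <= (sandwich c n).1 x /\
  (sandwich c n).2 x <= (sandwich c m).2 x.
Proof.
elim: n => [|n IH]; first by rewrite leqn0 => /eqP ->.
rewrite leq_eqVlt => /orP[/eqP -> //|/IH[l u]].
have [l' u'] := halve_le (a n) (c n) (sandwich c n) x.
by split; [exact: le_trans l'|exact: le_trans u].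
Qed.

Lemma sandwich_lub c m n x : unit c -> (sandwich c m).1 x <= (sandwich c n).2 x.
Proof.
move=> c1; have [_ _ le_mn] := sandwich_between (maxn m n) c1.
have [l _] := sandwich_mono c x (leq_maxl m n).
have [_ u] := sandwich_mono c x (leq_maxr m n).
exact: le_trans l (le_trans (le_mn x) u).
Qed.

Definition sandwiched c x : R := sup (range (fun n => (sandwich c n).1 x)).

Lemma sandwichedP c n x : unit c ->
  (sandwich c n).1 x <= sandwiched c x <= (sandwich c n).2 x.
Proof.
move=> c1; apply/andP; split.
  apply: ub_le_sup; last by exists n.
  by exists ((sandwich c 0).2 x) => _ [m _ <-]; exact: sandwich_lub.
apply: ge_sup; first by exists ((sandwich c 0).1 x), 0%N.
by move=> _ [m _ <-]; exact: sandwich_lub.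
Qed.

Lemma sandwiched_half_lipschitz c : unit c -> half_lipschitz (sandwiched c).
Proof.
move=> c1 x y; apply: ge_sup; first by exists ((sandwich c 0).1 x), 0%N.
move=> _ [m _ <-]; have [Ll _ _] := sandwich_between m c1.
by have /andP[l _] := sandwichedP m y c1; rewrite (le_trans (Ll x y))// lerD2r.
Qed.

Hypothesis a_dense : forall N, dense_range (fun i => a (N + i)%N).

(** Density of every tail provides fresh centres near [x] again and again, each of which nearly
    halves the width at [x]. That [n] does not depend on [c] is what later gives continuity in the
    parameters. *)
Lemma sandwich_width x (e : R) : 0 < e -> exists n, forall c, unit c ->
  (sandwich c n).2 x - (sandwich c n).1 x <= e.
Proof.
move=> e0; pose D := e / 6; have D0 : 0 < D by rewrite divr_gt0.
suff [n hn] : exists n, forall c, unit c ->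
    (sandwich c n).2 x - (sandwich c n).1 x <= 3 * D + e / 2.
  by exists n => c c1; rewrite (le_trans (hn c c1))// /D; lra.
(* Passing between [x] and a centre within [D] changes the width by at most [D], so one halving
   turns 3D + v into (4D + v)/2 + D = 3D + v/2; the term 3D is the fixed point. *)
have K k : exists n, forall c, unit c ->
    (sandwich c n).2 x - (sandwich c n).1 x <= 3 * D + 2 * M / 2 ^+ k.
  elim: k => [|k [n hn]].
    by exists 0%N => c _ /=; rewrite expr0 divr1; lra.
  have [i xi] := a_dense n x D0; exists (n + i).+1 => c c1.
  have := halve_width (a (n + i)) (c (n + i)%N) (sandwich c (n + i)).
  have [Ll Ul _] := sandwich_between (n + i).+1 c1.
  have [Ll' Ul' _] := sandwich_between (n + i) c1.
  have [l u] := sandwich_mono c x (leq_addr i n).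
  have := Ul x (a (n + i)%N); have := Ll (a (n + i)%N) x.
  have := Ul' (a (n + i)%N) x; have := Ll' x (a (n + i)%N).
  have -> : 2 * M / 2 ^+ k.+1 = (2 * M / 2 ^+ k) / 2.
    by rewrite exprS invfM; ring.
  have := hn c c1; rewrite (metric_sym _ x); move: (2 * M / 2 ^+ k) => v.
  rewrite /=; lra.
have : (fun k => 2 * M * 2^-1 ^+ k) @ \oo --> 2 * M * 0.
  by apply: cvgMr; apply: cvg_expr; rewrite ger0_norm//; lra.
rewrite mulr0 => /cvgr0Pnorm_lt/(_ (e / 2)); rewrite divr_gt0// => /(_ isT).
move=> [k _ /(_ k (leqnn k)) /= hk]; have [n hn] := K k.
exists n => c c1; apply: le_trans (hn c c1) _; rewrite lerD2l.
by rewrite -exprVn (le_trans (ler_norm _))// ltW.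
Qed.

(** Each bit aimed at [g] depends on the envelopes produced by the earlier bits; this recursion
    builds both together, so that the bits can be read off afterwards. *)
Fixpoint target_sandwich (g : X -> R) n : (X -> R) * (X -> R) :=
  if n is n'.+1 then
    let LU := target_sandwich g n' in
    halve (a n') (upper_half g (a n') LU)%:R LU
  else (fun=> - M, fun=> M).

Lemma sandwiched_surjective (g : X -> R) : half_lipschitz g ->
  (forall x, - M <= g x <= M) ->
  exists b : nat -> bool, sandwiched (fun n => (b n)%:R) = g.
Proof.
move=> gl gM; pose b n := upper_half g (a n) (target_sandwich g n).
pose c n : R := (b n)%:R; exists b; rewrite -/c.
have c1 : unit c by move=> n; rewrite /c; case: (b n); rewrite ?lexx ler01.
have cE n : sandwich c n = target_sandwich g n by elim: n => //= n ->.
have gLU n x : (sandwich c n).1 x <= g x <= (sandwich c n).2 x.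
  elim: n x => [|n IH] //=; apply: halve_target => //.
  by rewrite /c /b cE.
apply/funext => x; apply/eqP; rewrite -subr_eq0 -normr_le0.
apply/ler_addgt0Pr => e e0; rewrite add0r.
have [n /(_ c c1)] := sandwich_width x e0.
have /andP[] := sandwichedP n x c1; have /andP[] := gLU n x.
by rewrite ler_norml => *; lra.
Qed.

End sandwich.

(** * Half-Lipschitz families driven by Cantor coordinates *)

Section cantor_family.
Context {R : realType}.

(* A closed subset of [Z] maps onto the Cantor set by a map whose coordinates
   extend continuously to [Z]. *)
Definition cantor_coordinates (Z : topologicalType) (c : nat -> Z -> R) : Prop :=
  (forall i, continuous (c i)) /\
  forall b : nat -> bool, exists z, forall i, c i z = (b i)%:R.

Lemma continuous_maxr (Z : topologicalType) (f g : Z -> R) :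
  continuous f -> continuous g -> continuous (fun z => Num.max (f z) (g z)).
Proof.
by move=> fc gc z; apply: (@continuous_max R Z f g z); [exact: fc|exact: gc].
Qed.

Lemma continuous_minr (Z : topologicalType) (f g : Z -> R) :
  continuous f -> continuous g -> continuous (fun z => Num.min (f z) (g z)).
Proof.
by move=> fc gc z; apply: (@continuous_min R Z f g z); [exact: fc|exact: gc].
Qed.

Lemma cantor_coordinates_unit (Z : topologicalType) (c : nat -> Z -> R) :
  cantor_coordinates c -> exists c' : nat -> Z -> R,
    cantor_coordinates c' /\ forall i z, 0 <= c' i z <= 1.
Proof.
(* Clamping to [0, 1] preserves continuity and fixes the values 0 and 1. *)
move=> [cc cb]; exists (fun i z => Num.min 1 (Num.max 0 (c i z))); split.
  split=> [i|b].
    apply: continuous_minr; first by move=> ?; exact: cvg_cst.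
    by apply: continuous_maxr => [?|]; [exact: cvg_cst|exact: cc].
  have [z zb] := cb b; exists z => i; rewrite zb.
  by case: (b i); [rewrite max_r ?min_l|rewrite max_l ?min_r].
by move=> i z; rewrite le_min ge_min le_max !lexx ler01.
Qed.

Lemma sandwich_continuous (X : metricType R) (a : nat -> X) (M : R)
    (Z : topologicalType) (c : nat -> Z -> R) n x :
  (forall i, continuous (c i)) ->
  continuous (fun z => (sandwich a M (c ^~ z) n).1 x) /\
  continuous (fun z => (sandwich a M (c ^~ z) n).2 x).
Proof.
move=> cc; elim: n x => [|n IH] x; first by split => z; exact: cvg_cst.
have [Lx Ux] := IH x; have [Ln Un] := IH (a n).
have w z : {for z, continuous (fun z => ((sandwich a M (c ^~ z) n).2 (a n) -
    (sandwich a M (c ^~ z) n).1 (a n)) / 2)}.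
  by apply: cvgMl; apply: cvgB; [exact: Un|exact: Ln].
split=> /=.
  apply: continuous_maxr => // z; apply: cvgB; last exact: cvg_cst.
  by apply: cvgD; [exact: Ln|apply: cvgM; [exact: cc|exact: w]].
apply: continuous_minr => // z; apply: cvgD; last exact: cvg_cst.
apply: cvgB; first exact: Un.
by apply: cvgM; [apply: cvgB; [exact: cvg_cst|exact: cc]|exact: w].
Qed.

Lemma cantor_family (X : metricType R) (a : nat -> X) (M : R)
    (Z : topologicalType) (c : nat -> Z -> R) :
  (forall x y : X, mdist x y <= M) -> X ->
  (forall N, dense_range (fun i => a (N + i)%N)) ->
  cantor_coordinates c ->
  exists2 h : X -> Z -> R, half_lipschitz_family h
    & forall x z, `|h x z| <= M.
Proof.
move=> XM x0 ad /cantor_coordinates_unit[{}c [[cc cb] c01]].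
have M0 : 0 <= M by rewrite (le_trans (mdist_ge0 x0 x0)).
have c1 z n : 0 <= c n z <= 1 by [].
exists (fun x z => sandwiched a M (c ^~ z) x); last first.
  move=> x z; have := sandwichedP a M0 0 x (c1 z).
  by rewrite /= ler_norml.
split.
- move=> x z; apply/cvgrPdist_lt => e e0.
  have e30 : 0 < e / 3 by rewrite divr_gt0.
  (* This [n] serves all parameters at once: the limits at [z] and [y] lie within [e / 3] of their
     [n]-th lower envelopes, which vary continuously. *)
  have [n hn] := sandwich_width M0 ad x e30.
  have [Ln _] := sandwich_continuous a M n x cc.
  have /cvgrPdist_lt/(_ _ e30) := Ln z; apply: filterS => y.
  have := sandwichedP a M0 n x (c1 z); have := sandwichedP a M0 n x (c1 y).
  have := hn _ (c1 z); have := hn _ (c1 y).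
  by rewrite !ltr_norml => *; lra.
- move=> x y z; have := sandwiched_half_lipschitz a M0 (c1 z) x y.
  have := sandwiched_half_lipschitz a M0 (c1 z) y x.
  by rewrite (metric_sym y x) ler_norml => *; lra.
(* The point [x] itself serves as [a]: both signs of half the distance to [x] are half-Lipschitz and
   bounded by [M], hence reached by some 0-1 sequence of parameters. *)
- move=> x e e0; exists x.
  have gl : half_lipschitz (fun y => mdist y x / 2).
    by move=> y z; have := metric_triangle y z x; lra.
  have gl' : half_lipschitz (fun y => - (mdist y x / 2)).
    move=> y z; have := metric_triangle z y x; rewrite (metric_sym z y); lra.
  have [|b bE] := sandwiched_surjective M0 ad gl _.
    by move=> y; have := XM y x; have := mdist_ge0 y x; lra.
  have [|b' bE'] := sandwiched_surjective M0 ad gl' _.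
    by move=> y; have := XM y x; have := mdist_ge0 y x; lra.
  have [u ub] := cb b; have [v vb] := cb b'.
  exists u, v; rewrite mdistxx; split=> // y.
    rewrite -[RHS]/((fun y => mdist y x / 2) y) -bE.
    by congr (sandwiched _ _ _ _); apply/funext.
  rewrite -[RHS]/((fun y => - (mdist y x / 2)) y) -bE'.
  by congr (sandwiched _ _ _ _); apply/funext.
Qed.

End cantor_family.

(** * Cantor schemes in uncountable Polish spaces *)

Section perfect_set.
Context {R : realType} (X : topologicalType) (d : X -> X -> R).
Hypothesis dM : Met R X d.

Let d_ge0 := is_metric_ge0 dM.1.
Let dxx x : d x x = 0. Proof. by case: dM => [[]]. Qed.
Let dC x y : d x y = d y x. Proof. by case: dM => [[]]. Qed.
Let dT x y z : d x z <= d x y + d y z. Proof. by case: dM => [[]]. Qed.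

Lemma Met_continuous y : continuous (fun x => d x y).
Proof.
apply: (locally_lipschitz_continuous dM) => z; exists 1, 1; split=> // x _.
rewrite mul1r ler_norml; have := dT z x y; have := dT x z y.
by rewrite (dC x z) => *; lra.
Qed.

Lemma Met_dense (D : set X) : dense D ->
  forall x (e : R), 0 < e -> exists2 q, D q & d x q < e.
Proof.
move=> dD x e e0; have [||q [+ Dq]] := dD [set y | d x y < e]^°.
- by exists x; apply: nbhs_singleton; apply: nbhs_interior; exact: Met_nbhs.
- exact: open_interior.
by move=> /interior_subset xq; exists q.
Qed.

Definition condensation x := forall r : R, 0 < r ->
  ~ countable [set y | d x y < r].

(** A point that is not a condensation point lies in a countable ball with centre in [D] and radius
    1/(n+1); there are countably many such balls. *)
Lemma countable_not_condensation : separable X ->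
  countable [set x | ~ condensation x].
Proof.
move=> [D cD dD].
pose B q n := [set y | d q y < n.+1%:R^-1].
pose F q n := if pselect (countable (B q n)) then B q n else set0.
apply: (@sub_countable _ _ _ (\bigcup_(q in D) \bigcup_n F q n)).
  apply: subset_card_le => x /existsNP[r /not_implyP[r0 /contrapT cr]].
  have r20 : 0 < r / 2 by rewrite divr_gt0.
  have [n nr] := exists_invS_lt r20.
  have n0 : 0 < n.+1%:R^-1 :> R by rewrite invr_gt0.
  have [q Dq xq] := Met_dense dD x n0; exists q => //; exists n => //.
  rewrite /F; case: pselect => [_|[]] /=; first by rewrite /B/= dC.
  apply: sub_countable cr; apply: subset_card_le => y; rewrite /B /= => qy.
  rewrite (le_lt_trans (dT x q y))// (lt_trans (ltrD xq qy))//.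
  by have := ltrD nr nr; rewrite -splitr.
apply: bigcup_countable => // q _; apply: bigcup_countable => // n _.
by rewrite /F; case: pselect.
Qed.

(** The ball about [x] is uncountable, so [x] and the countably many points that are not
    condensation points cannot exhaust it. *)
Lemma condensation_split x (r : R) : separable X -> condensation x -> 0 < r ->
  exists y, [/\ condensation y, 0 < d x y & d x y < r].
Proof.
move=> sX xP r0; apply: contrapT => noy; apply: (xP r r0).
pose F b := if b then [set x] else [set x | ~ condensation x].
apply: (@sub_countable _ _ _ (\bigcup_b F b)); last first.
  apply: bigcup_countable => [|[] _]; [exact: countableP|exact: countable1|].
  exact: countable_not_condensation.
apply: subset_card_le => y /= xy.
have [yP|] := pselect (condensation y); last by exists false.
exists true => //=; apply: contrapT => yx; apply: noy; exists y; split => //.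
rewrite lt_neqAle d_ge0 andbT eq_sym; apply/eqP.
by case: dM => [[_ ds _ _] _] /ds/esym/yx.
Qed.

(* Nodes of the Cantor scheme are pairs (centre, radius). *)
Variable s : X * R -> X.

Definition valid (pr : X * R) := condensation pr.1 /\ 0 < pr.2.

Hypothesis sP : forall pr, valid pr ->
  [/\ condensation (s pr), 0 < d pr.1 (s pr) & d pr.1 (s pr) < pr.2 / 2].

(** With radius a quarter of the distance between the two centres, which is below half the parent
    radius, the children are disjoint and lie inside the parent ball. *)
Definition child (b : bool) (pr : X * R) : X * R :=
  (if b then s pr else pr.1, d pr.1 (s pr) / 4).

Lemma child_valid b pr : valid pr -> valid (child b pr).
Proof.
move=> vpr; have [sc s0 _] := sP vpr; case: vpr => pc _.
by split; [case: b|rewrite divr_gt0].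
Qed.

Lemma child_ball b pr x : valid pr ->
  d x (child b pr).1 <= (child b pr).2 -> d x pr.1 < pr.2.
Proof.
move=> vpr; have [_ s0 sr] := sP vpr; case: vpr => _ r0 /=.
have := dT x (s pr) pr.1; rewrite (dC (s pr)).
by case: b => * ; lra.
Qed.

Lemma child_disjoint b pr x : valid pr ->
  d x (child b pr).1 <= (child b pr).2 ->
  (child (~~ b) pr).2 < d x (child (~~ b) pr).1.
Proof.
move=> vpr; have [_ s0 sr] := sP vpr; case: vpr => _ r0 /=.
have := dT pr.1 x (s pr); rewrite (dC pr.1 x).
by case: b => /= *; lra.
Qed.

(** With δ the distance from [pr.1] to [s pr], this is 1 within δ/4 of [s pr] and 0 beyond δ/2. It
    thus separates the two children and vanishes off the parent ball. *)
Definition bump (pr : X * R) x : R :=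
  Num.max 0 (Num.min 1 (2 - d x (s pr) / (d pr.1 (s pr) / 4))).

(** This sums the bumps of all nodes [i] levels below [pr]; at a point of a branch only the node on
    that branch can contribute. *)
Fixpoint scheme_coord i (pr : X * R) x : R :=
  if i is j.+1 then
    scheme_coord j (child false pr) x + scheme_coord j (child true pr) x
  else bump pr x.

Lemma scheme_coord_continuous i pr : continuous (scheme_coord i pr).
Proof.
elim: i pr => [|i IH] pr x /=; last by apply: cvgD; exact: IH.
apply: continuous_maxr => [z|]; first exact: cvg_cst.
apply: continuous_minr => z; first exact: cvg_cst.
apply: cvgB; first exact: cvg_cst.
by apply: cvgMl; exact: Met_continuous.
Qed.

Lemma bump_child b pr x : valid pr ->
  d x (child b pr).1 <= (child b pr).2 -> bump pr x = b%:R.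
Proof.
move=> vpr; have [_ s0 _] := sP vpr; rewrite /bump.
have s40 : 0 < d pr.1 (s pr) / 4 by rewrite divr_gt0.
case: b => /= xb.
  rewrite min_l ?max_r// lerBrDl -lerBrDr ler_pdivrMr//; lra.
have h : 2 <= d x (s pr) / (d pr.1 (s pr) / 4).
  by rewrite ler_pdivlMr//; have := dT pr.1 x (s pr); rewrite (dC pr.1 x); lra.
by rewrite max_l// ge_min; apply/orP; right; lra.
Qed.

Lemma bump_out pr x : valid pr -> pr.2 <= d x pr.1 -> bump pr x = 0.
Proof.
move=> vpr rx; have [_ s0 sr] := sP vpr; rewrite /bump.
have s40 : 0 < d pr.1 (s pr) / 4 by rewrite divr_gt0.
have h : 2 <= d x (s pr) / (d pr.1 (s pr) / 4).
  rewrite ler_pdivlMr//; have := dT x (s pr) pr.1; rewrite (dC (s pr)); lra.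
by rewrite max_l// ge_min; apply/orP; right; lra.
Qed.

Lemma scheme_coord_out i pr x : valid pr -> pr.2 <= d x pr.1 ->
  scheme_coord i pr x = 0.
Proof.
elim: i pr => [|i IH] pr vpr rx /=; first exact: bump_out.
have out b : (child b pr).2 <= d x (child b pr).1.
  rewrite leNgt; apply/negP => /ltW/(child_ball vpr).
  by rewrite ltNge rx.
by rewrite !IH ?addr0//; exact: child_valid.
Qed.

Fixpoint branch (pr : X * R) (b : nat -> bool) n : X * R :=
  if n is m.+1 then child (b m) (branch pr b m) else pr.

Lemma branch_valid pr b n : valid pr -> valid (branch pr b n).
Proof. by move=> vpr; elim: n => //= n; exact: child_valid. Qed.

Lemma scheme_coord_branch pr b x : valid pr ->
  (forall n, d x (branch pr b n).1 <= (branch pr b n).2) ->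
  forall i, scheme_coord i pr x = (b i)%:R.
Proof.
move=> vpr xb i; rewrite -[in RHS](add0n i) -[pr in LHS]/(branch pr b 0).
elim: i 0%N => [|i IH] n /=.
  by rewrite addn0; apply: bump_child (xb n.+1); exact: branch_valid.
have vn := branch_valid b n vpr.
have other : scheme_coord i (child (~~ b n) (branch pr b n)) x = 0.
  apply: scheme_coord_out; first exact: child_valid.
  exact: ltW (child_disjoint vn (xb n.+1)).
have := IH n.+1; rewrite /= addSnnS => <-.
by case: (b n) other => /= ->; rewrite ?add0r ?addr0.
Qed.

Lemma branch_radius pr b n : valid pr ->
  (branch pr b n).2 <= pr.2 * 2^-1 ^+ n.
Proof.
move=> vpr; elim: n => [|n IH] /=; first by rewrite expr0 mulr1.
have [_ s0 sr] := sP (branch_valid b n vpr).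
rewrite exprS mulrCA; move: IH s0 sr; set u := pr.2 * _; lra.
Qed.

Lemma branch_ball pr b m n x : valid pr -> (m <= n)%N ->
  d x (branch pr b n).1 <= (branch pr b n).2 ->
  d x (branch pr b m).1 <= (branch pr b m).2.
Proof.
move=> vpr; elim: n => [|n IH]; first by rewrite leqn0 => /eqP ->.
rewrite leq_eqVlt => /orP[/eqP -> //|/IH{}IH] xn; apply: IH.
exact: ltW (child_ball (branch_valid b n vpr) xn).
Qed.

(** The centres are Cauchy because the balls are nested with radii tending to 0. The balls are
    closed so that the limit stays in each of them. *)
Lemma branch_limit pr b : valid pr -> complete_metric d ->
  exists x, forall n, d x (branch pr b n).1 <= (branch pr b n).2.
Proof.
move=> vpr dcomplete; pose u n := (branch pr b n).1.
have u_ball m n : (m <= n)%N -> d (u n) (u m) <= (branch pr b m).2.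
  move=> mn; apply: (branch_ball vpr mn).
  by rewrite dxx ltW//; case: (branch_valid b n vpr).
have [e e0|l ul] := dcomplete u.
  have : (fun k => pr.2 * 2^-1 ^+ k) @ \oo --> pr.2 * 0.
    by apply: cvgMr; apply: cvg_expr; rewrite ger0_norm//; lra.
  rewrite mulr0 => /cvgr0Pnorm_lt/(_ (e / 2)); rewrite divr_gt0// => /(_ isT).
  move=> [N _ /(_ N (leqnn N))] /= /(le_lt_trans (ler_norm _)) hN.
  exists N => m n Nm Nn; have := dT (u m) (u N) (u n); rewrite (dC (u N) (u n)).
  have := u_ball _ _ Nm; have := u_ball _ _ Nn; have := branch_radius b N vpr.
  lra.
exists l => n; apply/ler_addgt0Pr => e e0.
have /cvgr0Pnorm_lt/(_ _ e0)[N _ hN] := ul.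
have := hN (maxn n N) (leq_maxr _ _); rewrite /= ger0_norm// dC.
have := u_ball _ _ (leq_maxl n N); have := dT l (u (maxn n N)) (u n).
rewrite /u; lra.
Qed.

End perfect_set.

Lemma polish_cantor_coordinates {R : realType} (X : topologicalType) :
  polish R X -> ~ countable [set: X] ->
  exists c : nat -> X -> R, cantor_coordinates c.
Proof.
move=> [sX [d dM dcomplete]] ncX.
have [p pc] : exists p, condensation d p.
  apply: contrapT => /forallNP np; apply: ncX.
  apply: sub_countable (countable_not_condensation dM sX).
  by apply: subset_card_le => x _; exact: np.
(* The splitting point is chosen for all nodes at once, with [p] as a dummy value at invalid
   ones. *)
have [s sP] : {s : X * R -> X & forall pr, valid d pr ->
    [/\ condensation d (s pr),
    0 < d pr.1 (s pr) & d pr.1 (s pr) < pr.2 / 2]}.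
  apply: (@choice _ _ (fun pr y => valid d pr -> [/\ condensation d y,
    0 < d pr.1 y & d pr.1 y < pr.2 / 2])) => pr.
  have [[pc' r0]|nv] := pselect (valid d pr); last by exists p => /nv.
  have r20 : 0 < pr.2 / 2 by rewrite divr_gt0.
  by have [y] := condensation_split dM sX pc' r20; exists y.
have vp : valid d (p, 1) by split=> //=.
exists (fun i => scheme_coord d s i (p, 1)); split.
  by move=> i; exact: scheme_coord_continuous.
move=> b; have [x xb] := branch_limit dM sP b vp dcomplete.
by exists x => i; exact: (scheme_coord_branch dM sP vp xb).
Qed.

(** * Totally bounded spaces *)

Section totally_bounded.
Context {R : realType} (X : metricType R).
Hypothesis Xtb : totally_bounded X.

Lemma totally_bounded_bounded : bounded_space X.
Proof.
have [F /finite_seqP[s ->] sX] := Xtb ltr01.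
have [X0|/existsNP[x0 _]] := pselect (forall x : X, False).
  by exists 0 => x; have := X0 x.
have [M hM] : exists M, forall y, y \in s -> mdist x0 y <= M.
  elim: s {sX} => [|z s [M hM]]; first by exists 0.
  exists (Num.max (mdist x0 z) M) => y; rewrite inE le_max.
  by move=> /orP[/eqP ->|/hM ->]; rewrite ?lexx ?orbT.
have hb x : mdist x0 x <= M + 1.
  have : [set: X] x by [].
  rewrite -sX => -[y /= /hM y0]; rewrite ballEmdist /= => yx.
  by have := metric_triangle x0 y x; lra.
exists (2 * (M + 1)) => x y; have := metric_triangle x x0 y.
by have := hb x; have := hb y; rewrite (metric_sym x x0); lra.
Qed.

Lemma totally_bounded_separable : separable X.
Proof.
have inv_gt0 n : 0 < n.+1%:R^-1 :> R by rewrite invr_gt0.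
have /choice[F FP] n : exists F : set X, finite_set F /\
    \bigcup_(x in F) ball x (n.+1%:R^-1 : R) = [set: X].
  by have [F] := Xtb (inv_gt0 n); exists F.
exists (\bigcup_n F n).
  apply: bigcup_countable => // n _; apply: finite_set_countable.
  by case: (FP n).
move=> O [x Ox] oO.
have /(nbhs_ballP x)[e /= e0 eO] : nbhs x O by exact: open_nbhs_nbhs.
have [n ne] := exists_invS_lt e0; have [_ FX] := FP n.
have : [set: X] x by [].
rewrite -FX => -[y Fy xy]; exists y; split; last by exists n.
by apply: eO; apply: ball_sym; apply: le_ball xy; exact: ltW.
Qed.

Lemma totally_bounded_dense_sequence : X ->
  exists a : nat -> X, forall N, dense_range (fun i => a (N + i)%N).
Proof.
move=> x0.
have [a ad] := separable_dense_range x0 totally_bounded_separable infinite_nat.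
(* Reindexing by the 2-adic valuation repeats every value infinitely often: the index 2^k (2N + 1)
   is at least [N] and has valuation [k]. *)
exists (fun i => a (logn 2 i)) => N x e e0; have [k xk] := ad x e e0.
have Nk : (N <= 2 ^ k * N.*2.+1)%N.
  by rewrite (leq_trans _ (leq_pmull _ _)) ?expn_gt0// -addnn; lia.
exists (2 ^ k * N.*2.+1 - N)%N; rewrite subnKC// lognM ?expn_gt0// pfactorK//.
by rewrite (@logn_coprime 2) ?addn0// coprime2n /= odd_double.
Qed.

End totally_bounded.

(** * Universality from Cantor coordinates and from weight *)

Section cantor_universal.
Context {R : realType}.

Lemma universal_totally_bounded (Z : topologicalType) (c : nat -> Z -> R) :
  metrizable R Z -> cantor_coordinates c ->
  universal (BMet R Z) supdist totally_bounded.
Proof.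
move=> Zm cc; apply: universal_BMet => // X Xtb x0.
have [M XM] := totally_bounded_bounded Xtb.
have [a ad] := totally_bounded_dense_sequence Xtb x0.
have [h hP hM] := cantor_family XM x0 ad cc.
by exists h => // x; exists M.
Qed.

Lemma cantor_space_coordinates :
  cantor_coordinates (fun i (z : cantor_space) => (z i)%:R : R).
Proof.
split=> [i|b]; last by exists b.
apply: locally_constant_continuous => z.
have := @prod_topology_nbhs (fun=> bool) z i [set z i] (discrete_set1 _).
by apply: filterS => y /= ->.
Qed.

Lemma prod_topology_coord_continuous (T : nat -> topologicalType) i
    (f : T i -> R) :
  continuous f -> continuous (fun q : prod_topology T => f (q i)).
Proof.
move=> fc q.
exact: (@continuous_comp _ _ _ _ f q (@proj_continuous nat T i q) (fc (q i))).
Qed.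

Lemma hilbert_cube_coord_continuous i :
  continuous (fun q : hilbert_cube R => val (q i) : R).
Proof.
apply: (@prod_topology_coord_continuous (fun=> set_type `[(0 : R), 1]) i val).
exact: initial_continuous.
Qed.

Lemma surjection_coordinates (Z : topologicalType) (f : Z -> hilbert_cube R) :
  continuous f -> range f = [set: hilbert_cube R] ->
  cantor_coordinates (fun i z => val (f z i) : R).
Proof.
move=> fc fs; split=> [i z|b].
  by apply: (@continuous_comp _ _ _ f (fun q : hilbert_cube R => val (q i) : R));
    [exact: fc|exact: hilbert_cube_coord_continuous].
have b01 i : ((b i)%:R : R) \in `[(0 : R), 1]%classic.
  by apply/mem_set; rewrite /= in_itv /=; case: (b i); rewrite ?lexx ler01.
pose q : hilbert_cube R := fun i => SigSub (b01 i).
have : [set: hilbert_cube R] q by [].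
by rewrite -fs => -[z _ zq]; exists z => i; rewrite zq.
Qed.

End cantor_universal.

Lemma weight_universal {R : realType} (Z : topologicalType) (K : choiceType) :
  metrizable R Z -> infinite_set [set: K] ->
  (forall (X : metricType R) (a : K -> X), dense_range a ->
    exists2 h : X -> Z -> R, half_lipschitz_family h
      & forall x z, exists y, `|h x z| <= mdist x y / 2) ->
  universal (Met R Z) supdist (weight_class K) /\
  universal (BMet R Z) supdist (bounded_class (weight_class K)).
Proof.
move=> Zm iK H; split.
  apply: universal_Met => // X XK x0.
  have [a /H[h hP _]] := weight_class_dense_range x0 iK XK.
  by exists h.
apply: universal_BMet => // X [XK [M XM]] x0.
have [a /H[h hP hb]] := weight_class_dense_range x0 iK XK.
exists h => // x; exists (M / 2) => z; have [y xy] := hb x z.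
by rewrite (le_trans xy)// ler_pM2r ?invr_gt0.
Qed.

Unset Implicit Arguments.

Theorem theorem1p3 (R : realType) :
  (forall K : choiceType, infinite_set [set: K] ->
    [/\ universal (Met R (ell2 R K)) supdist (weight_class K),
        universal (Met R (baire_space K)) supdist (weight_class K),
        universal (BMet R (ell2 R K)) supdist (bounded_class (weight_class K))
      & universal (BMet R (baire_space K)) supdist
          (bounded_class (weight_class K))]) /\
  universal (BMet R (hilbert_cube R)) supdist totally_bounded /\
  ((forall Z : topologicalType, metrizable R Z ->
     (exists2 f : Z -> hilbert_cube R,
        continuous f & range f = [set: hilbert_cube R]) ->
     universal (BMet R Z) supdist totally_bounded) /\
   universal (BMet R cantor_space) supdist totally_bounded) /\
  (forall X : topologicalType, polish R X -> ~ countable [set: X] ->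
    universal (BMet R X) supdist totally_bounded).
Proof.
have cube (Z : topologicalType) : metrizable R Z ->
    (exists2 f : Z -> hilbert_cube R,
      continuous f & range f = [set: hilbert_cube R]) ->
    universal (BMet R Z) supdist totally_bounded.
  move=> Zm [f fc fs].
  exact: universal_totally_bounded Zm (surjection_coordinates fc fs).
split=> [K iK|].
  have ell2m : metrizable R (ell2 R K) by exists mdist; exact: Met_mdist.
  have [] := weight_universal ell2m iK (fun X a => @ell2_family R X K a).
  have [] := weight_universal (baire_metrizable K) iK
    (fun X a => @baire_family R X K a iK).
  by [].
split.
  apply: (cube (hilbert_cube R) hilbert_cube_metrizable).
  by exists id; [move=> q P|rewrite image_id].
split; first split.
- exact: cube.
- exact: universal_totally_bounded cantor_metrizable cantor_space_coordinates.
move=> X Xp ncX; have [c cc] := polish_cantor_coordinates Xp ncX.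
apply: universal_totally_bounded cc.
by case: Xp => _ [d dM _]; exists d.
Qed.
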